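(* Let $D\subsetneq\mathbb{C}$ be a multiply connected domain and let $\gamma$ be a non-trivial (rectifiable) closed curve in $D$. Then $$\int_\gamma m_D(z)\,|dz|\ge 2\pi.$$ Equality holds in the following limiting sense: for $D=\mathbb{D}_R^*=\{z\in\mathbb{C}:0<|z|<R\}$ and $\gamma=\{z:|z|=r\}$ with $0<r\le R/2$, one has $\int_\gamma m_D(z)\,|dz|\to 2\pi$ as $R\to\infty$ (with $r$ fixed), and also as $r\to 0$ (with $R$ fixed).
   Context: A closed curve in $D$ is called non-trivial if it is not homotopic in $D$ to a point; multiply connected means not simply connected. For a proper subdomain $D$ of $\mathbb{C}$, $\delta_D(z)=\inf\{|z-\xi|:\xi\in\partial D\}$ and $d(D)=\sup\{|x-y|:x,y\in D\}\in(0,\infty]$. The density $m_D(z)$ is $\frac{d(D)}{\delta_D(z)(d(D)-\delta_D(z))}$ if $D$ is bounded and $\frac{1}{\delta_D(z)}$ (the limit as $d(D)\to\infty$) if $D$ is unbounded. *)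

(* Defs.v *)
From HB Require Import structures.
From mathcomp Require Import all_boot all_order all_algebra.
From mathcomp Require Import complex.
From mathcomp Require Import all_classical all_reals all_analysis.
Set Implicit Arguments.
Unset Strict Implicit.
Unset Printing Implicit Defensive.
Import Order.TTheory GRing.Theory Num.Theory numFieldNormedType.Exports.

Local Open Scope classical_set_scope.
Local Open Scope ring_scope.

(* The complex plane is [Rcomplex R], the alias of R[i] whose norm
   Num.sqrt (Re z ^+ 2 + Im z ^+ 2) is R-valued (the norm of R[i] itself takes
   its values in R[i]).  It is equipped here with the topology of that norm. *)
Section complex_plane_topology.
Variable R : realType.

HB.instance Definition _ :=
  PseudoMetric.copy (Rcomplex R) (pseudoMetric_normed (Rcomplex R)).
HB.instance Definition _ := isPointed.Build (Rcomplex R) 0.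
HB.instance Definition _ :=
  NormedZmod_PseudoMetric_eq.Build R (Rcomplex R) erefl.

Lemma Rcomplex_normrZ (l : R) (z : Rcomplex R) : `|l *: z| = `|l| * `|z|.
Proof.
by case: z => a b; rewrite /Num.norm /= !exprMn -mulrDr sqrtrM ?sqr_ge0// sqrtr_sqr.
Qed.

HB.instance Definition _ :=
  PseudoMetricNormedZmod_Lmodule_isNormedModule.Build R (Rcomplex R)
    Rcomplex_normrZ.

End complex_plane_topology.

Section domains_and_density.
Variable R : realType.
Local Notation C := (Rcomplex R).
Implicit Types (D : set C) (g : R -> C) (z : C).

Definition domain D := [/\ open D, connected D & D !=set0].

Definition boundary D : set C := closure D `\` D°.

Definition closed_curve_in D g :=
  [/\ {within `[0, 1], continuous g}, g 0 = g 1 & g @` `[0, 1] `<=` D].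

(* free homotopy, through closed curves in D; the first coordinate of H is the
   time of the homotopy *)
Definition closed_homotopic_in D g0 g1 := exists H : R * R -> C,
  [/\ {within `[0, 1] `*` `[0, 1], continuous H},
      H @` (`[0, 1] `*` `[0, 1]) `<=` D,
      {in `[0, 1], forall s, H (0, s) = g0 s},
      {in `[0, 1], forall s, H (1, s) = g1 s} &
      {in `[0, 1], forall t, H (t, 0) = H (t, 1)}].

Definition null_homotopic_in D g :=
  exists2 p, D p & closed_homotopic_in D g (fun=> p).

Definition simply_connected D :=
  connected D /\ (forall g, closed_curve_in D g -> null_homotopic_in D g).

Definition multiply_connected D := ~ simply_connected D.

Definition dist_boundary D z : R := inf [set `|z - xi| | xi in boundary D].

Definition diameter D : \bar R :=
  ereal_sup [set `|p.1 - p.2|%R%:E | p in D `*` D].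

(* the diameter of a nonempty set is +oo exactly when it is unbounded, and is
   never -oo *)
Definition m_density D z : R :=
  let delta := dist_boundary D z in
  if diameter D is d%:E then d / (delta * (d - delta)) else delta^-1.

(* length of the polygonal line inscribed in g with vertices at a :: s; this is
   the library's [variation], which is only available for real-valued g *)
Definition chord_sum a b g (s : seq R) : R := let F := g \o nth b (a :: s) in
  \sum_(0 <= n < size s) `|F n.+1 - F n|.

Definition arc_length a b g : \bar R :=
  ereal_sup [set (chord_sum a b g s)%:E | s in itv_partition a b].

Definition rectifiable g := (arc_length 0%R 1%R g < +oo)%E.

(* For g continuous and rectifiable on [0, 1] and s between 0 and its length,
   this is g t for any t such that g has length s on [0, t]: such a t exists,
   and two of them are bounds of an interval on which g is constant. *)
Definition arc_length_param g (s : R) : C :=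
  g (xget 0 [set t | 0 <= t <= 1 /\ arc_length 0%R t g = s%:E]).

(* the integral of f over g with respect to arc length |dz| *)
Definition arc_length_integral g (f : C -> R) : \bar R :=
  (\int[lebesgue_measure]_(s in `[0%R, fine (arc_length 0%R 1%R g)])
    (f (arc_length_param g s))%:E)%E.

Definition punctured_disc (rho : R) : set C := [set z | 0 < `|z| < rho].

Definition circle (r : R) : R -> C :=
  fun t => ((r * cos (2 * pi * t)) +i* (r * sin (2 * pi * t)))%C.

End domains_and_density.

(* Main.v *)
Require Import Defs.
From mathcomp Require Import all_boot all_order all_algebra.
From mathcomp Require Import complex ring lra.
From mathcomp Require Import all_classical all_reals all_analysis.
Import Order.TTheory GRing.Theory Num.Theory numFieldNormedType.Exports.
Local Open Scope classical_set_scope.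
Local Open Scope ring_scope.
Set Implicit Arguments.
Unset Strict Implicit.
Unset Printing Implicit Defensive.

(** Lower bound.  Suppose that the closed curve [g] is not null-homotopic in [D].
    The straight-line homotopy from [g] to the constant curve at [g 0] must then
    leave [D], so some segment from [g t] to [g 0] contains a point outside [D],
    and hence a boundary point [a] of [D] ([segment_meets_boundary]).  Seen from
    [a], the points [g 0] and [g t] are in opposite directions, so each of the
    two arcs of [g] that they bound sweeps around [a] an angle at least pi.  The
    angle swept by an arc is at most the integral of 1/|z - a| with respect to
    arc length ([pi_le_integral_opposite]), so the integral of 1/|z - a| over [g]
    is at least 2 pi ([two_pi_le_integral_inv_dist]).  Finally [m_density D] is
    at least the inverse of the distance to the boundary, hence at least
    1/|z - a| ([m_density_ge_inv_dist]).  No winding number and no separation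
    theorem for curves is needed.

    The angle bound is proved for the arc-length parametrization, which is
    1-Lipschitz, without differentiating it.  A short chord is seen under an
    angle at most 1 + e times the integral along its arc
    ([cos_angle_chord], [cos_short_angle]), and angles are subadditive ([cos_angleD]), so the bound
    propagates to the whole arc by small steps; then e tends to 0.  That the
    parametrization is defined and 1-Lipschitz rests on the continuity of arc
    length as a function of the endpoint ([arc_length_continuous]).

    Limits.  For 2 r <= rho the circle of radius r is at distance r from the
    boundary of the punctured disc, whose diameter is 2 rho, so the integral is
    2 pi / (1 - r / (2 rho)), which tends to 2 pi when r / rho tends to 0.  The
    circle has length 2 pi r: inscribed polygons are no longer than that, and
    the converse is the angle bound above applied to the centre. *)

(** * Elementary bounds on sine and cosine *)

Section trigonometric_bounds.
Variable R : realType.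
Implicit Types x y a b q e : R.

Lemma sin_le_id x : 0 <= x -> sin x <= x.
Proof.
move=> x0.
have [c _] := @MVT_segment R sin cos 0 x x0 (fun t _ => is_derive_sin t)
  (continuous_subspaceT (@continuous_sin R)).
rewrite sin0 !subr0 => ->.
by rewrite -[leRHS]mul1r ler_wpM2r// cos_le1.
Qed.

Lemma cos_ge_quadratic x : 1 - x ^+ 2 / 2 <= cos x.
Proof.
have -> : cos x = 1 - 2 * sin (`|x| / 2) ^+ 2.
  by rewrite -cos_norm {1}(_ : `|x| = (`|x| / 2) *+ 2); 
    rewrite ?cos_mulr2n ?cos2sin2; [lra|rewrite -mulr_natr; field].
have [hx|hx] := leP 2 `|x|.
  have : 2 ^+ 2 <= `|x| ^+ 2 by rewrite lerXn2r// nnegrE.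
  rewrite real_normK ?num_real// => h.
  have := cos_geN1 (`|x|/2 *+ 2); rewrite cos_mulr2n cos2sin2; lra.
have s0 : 0 <= sin (`|x| / 2).
  apply: sin_ge0_pi; have := pi_ge2 R; have := normr_ge0 x; lra.
have h : sin (`|x| / 2) <= `|x| / 2 by apply: sin_le_id; rewrite divr_ge0.
have : sin (`|x| / 2) ^+ 2 <= (`|x| / 2) ^+ 2 by rewrite lerXn2r// nnegrE divr_ge0.
rewrite expr_div_n real_normK ?num_real//; lra.
Qed.

Lemma sin_ge_cubic x : 0 <= x -> x * (1 - x ^+ 2 / 2) <= sin x.
Proof.
move=> x0.
have [c] := @MVT_segment R sin cos 0 x x0 (fun t _ => is_derive_sin t)
  (continuous_subspaceT (@continuous_sin R)).
rewrite in_itv/= sin0 !subr0 => /andP[c0 cx] ->.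
rewrite mulrC ler_wpM2r//; apply: le_trans (cos_ge_quadratic c).
by rewrite lerB// ler_wpM2r// lerXn2r// nnegrE.
Qed.

Lemma cos_le_quartic x : 0 <= x <= 1 ->
  cos x <= 1 - x ^+ 2 / 2 * (1 - x ^+ 2 / 4).
Proof.
move=> /andP[x0 x1]; have y0 : 0 <= x / 2 by rewrite divr_ge0.
have -> : cos x = 1 - 2 * sin (x / 2) ^+ 2.
  by rewrite {1}(_ : x = (x / 2) *+ 2);
    rewrite ?cos_mulr2n ?cos2sin2; [lra|rewrite -mulr_natr; field].
have h := sin_ge_cubic y0.
have x2 : x ^+ 2 <= 1 by rewrite expr_le1.
have h0 : 0 <= x / 2 * (1 - (x / 2) ^+ 2 / 2).
  by rewrite mulr_ge0// expr_div_n; lra.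
have : (x / 2 * (1 - (x / 2) ^+ 2 / 2)) ^+ 2 <= sin (x / 2) ^+ 2.
  by rewrite lerXn2r// nnegrE// (le_trans h0).
move=> /(fun h => lerB (lexx 1) (ler_wpM2l (ler0n R 2) h)) /le_trans; apply.
rewrite -subr_ge0; suff -> : 1 - x ^+ 2 / 2 * (1 - x ^+ 2 / 4) -
    (1 - 2 * (x / 2 * (1 - (x / 2) ^+ 2 / 2)) ^+ 2) = x ^+ 6 / 128.
  by rewrite divr_ge0// exprn_ge0.
by field.
Qed.

(** For [q] the ratio of the length of a chord to the distance of its first end
    to the origin, the right-hand side bounds from below the cosine of the angle
    under which the chord is seen ([cos_angle_chord]); this angle is thus at most
    [(1 + e) * (q / (1 + q))]. *)
Lemma cos_short_angle e q : 0 < e <= 1 / 2 -> 0 <= q <= e / 20 ->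
  cos ((1 + e) * (q / (1 + q))) <= 1 - q ^+ 2 / (2 * (1 - q)).
Proof.
move=> /andP[e0 e1] /andP[q0 qe].
set t := (1 + e) * (q / (1 + q)).
have q1 : 0 < 1 + q by lra.
have t0 : 0 <= t by rewrite mulr_ge0 ?divr_ge0//; lra.
have tq : t <= 2 * q.
  rewrite /t mulrA ler_pdivrMr//; nra.
apply: (le_trans (@cos_le_quartic t _)); first by rewrite t0/=; lra.
have te : t ^+ 2 <= e by rewrite (@le_trans _ _ ((2 * q) ^+ 2))// ?lerXn2r ?nnegrE//; nra.
apply: (@le_trans _ _ (1 - t ^+ 2 / 2 * (1 - e))).
  rewrite lerB// ler_wpM2l ?divr_ge0 ?sqr_ge0//; lra.
rewrite lerB// /t exprMn expr_div_n.
have -> : (1 + e) ^+ 2 * (q ^+ 2 / (1 + q) ^+ 2) / 2 * (1 - e) =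
   (q ^+ 2 / 2) * ((1 + e) ^+ 2 * (1 - e) / (1 + q) ^+ 2) by field; lra.
have -> : q ^+ 2 / (2 * (1 - q)) = q ^+ 2 / 2 * (1 - q)^-1 by field; lra.
rewrite ler_wpM2l ?divr_ge0 ?sqr_ge0//.
rewrite ler_pdivlMr ?exprn_gt0// mulrC ler_pdivrMr; last lra.
have h1 : 1 + e / 4 <= (1 + e) ^+ 2 * (1 - e).
  have : 0 <= e * ((1 / 2 - e) * (3 / 2 + e)) by rewrite !mulr_ge0//; lra.
  nra.
have h2 : (1 + q) ^+ 2 <= (1 + e / 4) * (1 - q).
  have : 0 <= q * (1 - q) by rewrite mulr_ge0//; lra.
  have : 0 <= e * (1 - q) by rewrite mulr_ge0//; lra.
  have : 0 <= q * (1/2 - e) by rewrite mulr_ge0//; lra.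
  lra.
apply: (le_trans h2); rewrite ler_wpM2r//; lra.
Qed.

End trigonometric_bounds.

(** * Angles between plane vectors *)

Section angle.
Variable R : realType.
Local Notation C := (Rcomplex R).
Implicit Types (x y z : C) (a b r : R).

(** Cosine of the angle between [x] and [y]; it is 0 when one of them is 0. *)
Definition cos_angle x y : R :=
  (complex.Re x * complex.Re y + complex.Im x * complex.Im y) / (`|x| * `|y|).

Lemma Rcomplex_norm_sqr x : `|x| ^+ 2 = complex.Re x ^+ 2 + complex.Im x ^+ 2.
Proof. by case: x => a b; rewrite /Num.norm/= sqr_sqrtr// addr_ge0// sqr_ge0. Qed.

Lemma cos_angle_le1 x y : -1 <= cos_angle x y <= 1.
Proof.
have [->|x0] := eqVneq x 0.
  by rewrite /cos_angle normr0 (mul0r `|y|) invr0 (mulr0 (_ + _)); lra.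
have [->|y0] := eqVneq y 0.
  by rewrite /cos_angle normr0 (mulr0 `|x|) invr0 (mulr0 (_ + _)); lra.
rewrite -ler_norml -(ler_pXn2r (ltn0Sn 1)) ?nnegrE//.
rewrite expr1n real_normK ?num_real// expr_div_n ler_pdivrMr; last first.
  by rewrite exprn_gt0// mulr_gt0 ?normr_gt0.
rewrite mul1r exprMn !Rcomplex_norm_sqr.
have := sqr_ge0 (complex.Re x * complex.Im y - complex.Im x * complex.Re y).
nra.
Qed.

Lemma cos_angleNZ x k : x != 0 -> 0 < k -> cos_angle x (- (k *: x)) = -1.
Proof.
move=> x0 k0; rewrite /cos_angle normrN normrZ gtr0_norm//.
have : `|x| ^+ 2 != 0 by rewrite sqrf_eq0 normr_eq0.
have -> : `|x| * (k * `|x|) = k * `|x| ^+ 2 by ring.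
rewrite Rcomplex_norm_sqr; case: x {x0} => u v /= h.
by field; rewrite h gt_eqF.
Qed.

Lemma cos_anglexx x : x != 0 -> cos_angle x x = 1.
Proof.
move=> x0; rewrite /cos_angle -!expr2 -Rcomplex_norm_sqr divff//.
by rewrite sqrf_eq0 normr_eq0.
Qed.

(** Non-strict form of [ltr_cos]. *)
Lemma ler_cos : {in `[0, pi] &, {mono (@cos R) : a b /~ b <= a}}.
Proof. by move=> a b ha hb; rewrite leNgt [RHS]leNgt ltr_cos. Qed.

(** Angles between vectors satisfy the triangle inequality. *)
Lemma cos_angleD x y z a b : x != 0 -> y != 0 -> z != 0 ->
  0 <= a -> 0 <= b -> a + b <= pi ->
  cos a <= cos_angle x y -> cos b <= cos_angle y z ->
  cos (a + b) <= cos_angle x z.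
Proof.
move=> x0 y0 z0 a0 b0 abpi axy byz.
set p := cos_angle x y; set q := cos_angle y z.
have [pI qI] : -1 <= p <= 1 /\ -1 <= q <= 1 by split; exact: cos_angle_le1.
have [A0 Api] := (acos_ge0 pI, acos_lepi pI).
have [B0 Bpi] := (acos_ge0 qI, acos_lepi qI).
have cA : cos (acos p) = p by rewrite acosK// in_itv.
have cB : cos (acos q) = q by rewrite acosK// in_itv.
have Aa : acos p <= a by rewrite -ler_cos ?in_itv/= ?A0 ?a0 ?cA//; lra.
have Bb : acos q <= b by rewrite -ler_cos ?in_itv/= ?B0 ?b0 ?cB//; lra.
have : cos (a + b) <= cos (acos p + acos q).
  by rewrite ler_cos ?in_itv/=; lra.
move=> /le_trans; apply.
rewrite cosD cA cB !sin_acos//.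
(* u and v are the sines of the oriented angles from x to y and from y to z;
   the angles given by acos determine them up to sign *)
pose u := (complex.Re x * complex.Im y - complex.Im x * complex.Re y) / (`|x| * `|y|).
pose v := (complex.Re y * complex.Im z - complex.Im y * complex.Re z) / (`|y| * `|z|).
have nx : `|x| != 0 by rewrite normr_eq0.
have ny : `|y| != 0 by rewrite normr_eq0.
have nz : `|z| != 0 by rewrite normr_eq0.
have Ex : `|x| ^+ 2 != 0 by rewrite sqrf_eq0.
have Ey : `|y| ^+ 2 != 0 by rewrite sqrf_eq0.
have Ez : `|z| ^+ 2 != 0 by rewrite sqrf_eq0.
have -> : 1 - p ^+ 2 = u ^+ 2.
  rewrite /p /u /cos_angle !expr_div_n !exprMn; move: Ex Ey.
  rewrite !Rcomplex_norm_sqr; move: (x) (y) => [? ?] [? ?] /= ? ?.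
  by field; apply/andP.
have -> : 1 - q ^+ 2 = v ^+ 2.
  rewrite /q /v /cos_angle !expr_div_n !exprMn; move: Ey Ez.
  rewrite !Rcomplex_norm_sqr; move: (y) (z) => [? ?] [? ?] /= ? ?.
  by field; apply/andP.
have -> : cos_angle x z = p * q - u * v.
  rewrite /p /q /u /v /cos_angle.
  set a1 := complex.Re x; set a2 := complex.Im x.
  set b1 := complex.Re y; set b2 := complex.Im y.
  set c1 := complex.Re z; set c2 := complex.Im z.
  have -> : a1 * c1 + a2 * c2 = (a1 * c1 + a2 * c2) * (b1 ^+ 2 + b2 ^+ 2) / `|y| ^+ 2.
    by rewrite -Rcomplex_norm_sqr mulfK.
  by field; rewrite nx ny nz.
rewrite !sqrtr_sqr lerB// -normrM; exact: ler_norm.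
Qed.

(** Lower bound on the cosine of the angle under which a chord of length at
    most [r], starting at [x], is seen from the origin. *)
Lemma cos_angle_chord x y r : 0 <= r < `|x| -> `|y - x| <= r ->
  1 - r ^+ 2 / (2 * (`|x| * (`|x| - r))) <= cos_angle x y.
Proof.
move=> /andP[r0 rx] xyr.
have yr : `|x| - r <= `|y|.
  have := lerB_normD x (y - x); rewrite (addrC x) subrK; lra.
have nx : 0 < `|x| by lra.
have ny : 0 < `|y| by lra.
have h : `|y - x| ^+ 2 <= r ^+ 2 by rewrite lerXn2r ?nnegrE.
have -> : cos_angle x y = 1 + ((`|x| - `|y|) ^+ 2 - `|y - x| ^+ 2) / (2 * (`|x| * `|y|)).
  have -> : `|y - x| ^+ 2 = `|x| ^+ 2 + `|y| ^+ 2 - 2 *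
      (complex.Re x * complex.Re y + complex.Im x * complex.Im y).
    rewrite !Rcomplex_norm_sqr; move: (x) (y) => [? ?] [? ?] /=; ring.
  by rewrite /cos_angle; field; rewrite !gt_eqF.
rewrite lerD2l -mulNr.
apply: (@le_trans _ _ (- r ^+ 2 / (2 * (`|x| * `|y|)))).
  rewrite !mulNr lerN2 ler_wpM2l ?sqr_ge0//.
  rewrite lef_pV2 ?posrE ?mulr_gt0 ?subr_gt0// ?ler_pM2l//.
rewrite ler_wpM2r ?invr_ge0 ?mulr_ge0//.
have := sqr_ge0 (`|x| - `|y|); lra.
Qed.

End angle.

(** * Arc length and its parametrization *)

Section segment_continuity.
Variables (R : realType) (V : normedModType R).
Implicit Types (f : R -> V) (a b x y d e : R).

Lemma within_segment_continuousP f a b :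
  {within `[a, b], continuous f} <->
  (forall x e, a <= x <= b -> 0 < e -> exists2 d, 0 < d &
    forall y, a <= y <= b -> `|y - x| < d -> `|f y - f x| < e).
Proof.
split=> [/subspace_continuousP cf x e xab e0|cf].
  have := cf x; rewrite /= in_itv/= => /(_ xab) /cvgrPdist_lt /(_ e e0).
  move=> /nbhs_ballP[d/= d0 dP]; exists d => // y yab yx.
  by rewrite distrC; apply: dP; rewrite /= ?in_itv//= -ball_normE/= distrC.
apply/subspace_continuousP => x /=; rewrite in_itv/= => xab.
apply/cvgrPdist_lt => e e0; have [d d0 dP] := cf x e xab e0.
apply/nbhs_ballP; exists d => //= y.
rewrite -ball_normE/= distrC => yx; rewrite in_itv/= => yab.
by rewrite distrC; exact: dP.
Qed.

(** Projection of the line onto the segment from [a] to [b]. *)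
Definition clamp a b x := Num.max a (Num.min x b).

Lemma clamp_itv a b x : a <= b -> a <= clamp a b x <= b.
Proof. by move=> ab; rewrite /clamp le_max lexx/= ge_max ab ge_min lexx orbT. Qed.

Lemma clamp_id a b x : a <= x <= b -> clamp a b x = x.
Proof. by move=> /andP[ax xb]; rewrite /clamp (min_l xb) max_r. Qed.

Lemma clamp_lipschitz a b x y : a <= b -> `|clamp a b y - clamp a b x| <= `|y - x|.
Proof.
move=> ab; wlog xy : x y / x <= y => [H|].
  by have [/H//|/ltW/H] := leP x y; rewrite distrC [leRHS]distrC.
rewrite [leRHS]ger0_norm ?subr_ge0// ler_norml /clamp.
by case: (leP x b); case: (leP y b); case: (leP a x); case: (leP a y);
  case: (leP a b) => *; lra.
Qed.

Lemma continuous_clamp f a b : a <= b -> {within `[a, b], continuous f} ->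
  continuous (fun x => f (clamp a b x)).
Proof.
move=> ab /within_segment_continuousP cf x.
apply/cvgrPdist_lt => e e0; have [d d0 dP] := cf _ e (clamp_itv x ab) e0.
apply/nbhs_ballP; exists d => // y; rewrite /ball/= distrC => yx.
rewrite distrC dP ?clamp_itv//; exact: le_lt_trans (clamp_lipschitz _ _ ab) yx.
Qed.

End segment_continuity.

Section arc_length.
Variable R : realType.
Local Notation C := (Rcomplex R).
Implicit Types (g : R -> C) (a b c t x e : R) (s : seq R).

Lemma chord_sum_nil a b g : chord_sum a b g [::] = 0.
Proof. by rewrite /chord_sum big_geq. Qed.

Lemma chord_sum_cons a b g x s :
  chord_sum a b g (x :: s) = `|g x - g a| + chord_sum x b g s.
Proof. by rewrite /chord_sum/= big_nat_recl. Qed.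

(** The vertex [b] after which [c] is appended is the last one, but the default
    vertices of the two sums differ; they are never used. *)
Lemma chord_sum_rcons a b c g s : last a s = b ->
  chord_sum a c g (rcons s c) = chord_sum a b g s + `|g c - g b|.
Proof.
elim: s a => [a/= ->|x s IH a/= sb].
  by rewrite chord_sum_cons !chord_sum_nil addr0 add0r.
by rewrite !chord_sum_cons IH// addrA.
Qed.

Lemma chord_sum_arc_length a b g s : itv_partition a b s ->
  ((chord_sum a b g s)%:E <= arc_length a b g)%E.
Proof. by move=> ps; apply: ereal_sup_ubound; exists s. Qed.

Lemma arc_length_ge0 a b g : a <= b -> (0 <= arc_length a b g)%E.
Proof.
rewrite le_eqVlt => /predU1P[->|ab].
  have := @chord_sum_arc_length b b g [::]; rewrite chord_sum_nil; apply.
  by split=> //=.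
apply: le_trans (chord_sum_arc_length g (itv_partition1 ab)).
by rewrite chord_sum_cons chord_sum_nil addr0 lee_fin.
Qed.

(** Prolonging a curve lengthens it by at least the added chord. *)
Lemma arc_length_chord a b c g : b < c ->
  (arc_length a b g + `|g c - g b|%:E <= arc_length a c g)%E.
Proof.
move=> bc; rewrite -leeBrDr//; apply: ge_ereal_sup => _ [s ps <-].
rewrite leeBrDr// -EFinD; have [sp /eqP sb] := ps.
rewrite -(chord_sum_rcons c g sb); apply: chord_sum_arc_length.
by split; rewrite ?last_rcons// rcons_path sp sb.
Qed.

Lemma arc_lengthxx a g : arc_length a a g = 0%E.
Proof.
apply/eqP; rewrite eq_le arc_length_ge0// andbT.
by apply: ge_ereal_sup => _ [s /itv_partitionxx -> <-]; rewrite chord_sum_nil.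
Qed.

End arc_length.

Section rectifiable_curve.
Variables (R : realType) (g : R -> Rcomplex R).
Hypothesis g_cont : {within `[0, 1], continuous g}.
Hypothesis g_rect : rectifiable g.
Implicit Types (a b t x e : R) (s : seq R).

Local Notation ell t := (fine (arc_length 0 t g)).

Lemma arc_length_fineK t : 0 <= t <= 1 -> (ell t)%:E = arc_length 0 t g.
Proof.
move=> /andP[t0 t1]; apply: fineK; rewrite ge0_fin_numE ?arc_length_ge0//.
apply: le_lt_trans g_rect; move: t1; rewrite le_eqVlt => /predU1P[->//|t1].
by apply: le_trans (arc_length_chord 0 g t1); rewrite leeDl.
Qed.

Lemma arc_length_dist t x : 0 <= t -> t <= x -> x <= 1 ->
  `|g x - g t| <= ell x - ell t.
Proof.
move=> t0; rewrite le_eqVlt => /predU1P[->|tx] x1; first by rewrite !subrr normr0.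
rewrite lerBrDl -lee_fin EFinD !arc_length_fineK ?t0/=; last 2 first.
- by rewrite x1 (le_trans t0)// ltW.
- exact: le_trans (ltW tx) x1.
exact: arc_length_chord.
Qed.

Lemma arc_length_le t x : 0 <= t -> t <= x -> x <= 1 -> ell t <= ell x.
Proof. by move=> t0 tx x1; rewrite -subr_ge0 (le_trans _ (arc_length_dist t0 tx x1)). Qed.

(** When no vertex lies strictly between [t] and [x], the inscribed polygonal
    line is at most as long as the curve with its arc from [t] to [x] replaced
    by a chord. *)
Lemma chord_sum_shortcut a b s t x : itv_partition a b s -> 0 <= a -> b <= 1 ->
  a <= t -> t <= x -> x <= b -> (forall y, y \in s -> y <= t \/ x <= y) ->
  chord_sum a b g s <= (ell t - ell a) + `|g x - g t| + (ell b - ell x).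
Proof.
elim: s a t x => [a t x /itv_partition_nil <- a0 b1 at' tx xa _|
  y s IH a t x ps a0 b1 at' tx xb sep].
  have -> : t = a by lra.
  have -> : x = a by lra.
  by rewrite chord_sum_nil !subrr normr0 !addr0.
have ps' := itv_partition_cons ps; have yb := itv_partition_le ps'.
have ay : a < y by case: ps => /= /andP[].
have sep' z : z \in s -> z <= t \/ x <= z.
  by move=> zs; apply: sep; rewrite in_cons zs orbT.
rewrite chord_sum_cons; have [|yt|xy] := sep y; first by rewrite in_cons eqxx.
  have := IH y t x ps' (le_trans a0 (ltW ay)) b1 yt tx xb sep'.
  have := arc_length_dist a0 (ltW ay) (le_trans yb b1); lra.
have h1 := arc_length_dist a0 at' (le_trans (le_trans tx xb) b1).
have h2 := arc_length_dist (le_trans a0 (le_trans at' tx)) xy (le_trans yb b1).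
have h3 : chord_sum y b g s <= ell b - ell y.
  have y0 : 0 <= y by lra.
  have := IH y y y ps' y0 b1 (lexx y) (lexx y) yb.
  rewrite !subrr normr0 !add0r; apply => z zs; right.
  have [pth _] := ps'.
  exact: ltW (allP (order_path_min lt_trans pth) z zs).
have : `|g y - g a| <= `|g t - g a| + `|g x - g t| + `|g y - g x|.
  have -> : g y - g a = (g t - g a) + (g x - g t) + (g y - g x).
    by rewrite [RHS]addrC [g t - g a + _]addrC !addrA !subrK.
  by rewrite (le_trans (ler_normD _ _))// lerD2r ler_normD.
lra.
Qed.

Lemma arc_length_continuous : {within `[0, 1], continuous (fun t => ell t)}.
Proof.
apply/(@within_segment_continuousP R R) => t e t01 e0.
have e20 : 0 < e / 2 by rewrite divr_gt0.
have [d1 d10 d1P] := (@within_segment_continuousP _ _ g 0 1).1 g_cont t _ t01 e20.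
(* the length of an arc containing no vertex of an almost optimal partition
   in its interior is almost that of its chord *)
have [s ps ls] : exists2 s, itv_partition 0 1 s & ell 1 - e / 2 < chord_sum 0 1 g s.
  have fin1 : arc_length 0 1 g \is a fin_num by rewrite -arc_length_fineK ?lexx ?ler01.
  have [_ [s ps <-]] := ub_ereal_sup_adherent e20 fin1.
  rewrite -/(arc_length 0 1 g) -arc_length_fineK ?lexx ?ler01// -EFinB lte_fin.
  by exists s.
have short u v : 0 <= u -> u <= v -> v <= 1 ->
    (forall y, y \in s -> y <= u \/ v <= y) -> ell v - ell u < `|g v - g u| + e / 2.
  move=> u0 uv v1 sep.
  have := chord_sum_shortcut ps (lexx _) (lexx _) u0 uv v1 sep.
  rewrite arc_lengthxx/=; lra.
have [d2 d20 d2P] : exists2 d, 0 < d & forall y, y \in s -> y != t -> d <= `|y - t|.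
  elim: s {ps ls short} => [|y s [d d0 dP]]; first by exists 1.
  have [->|yt] := eqVneq y t.
    by exists d => // z; rewrite in_cons => /predU1P[->|/dP//]; rewrite eqxx.
  exists (Num.min d `|y - t|); first by rewrite lt_min d0 normr_gt0 subr_eq0.
  move=> z; rewrite in_cons => /predU1P[->|/dP h] zt; rewrite ge_min ?lexx ?orbT//.
  by rewrite h.
exists (Num.min d1 d2); first by rewrite lt_min d10.
move=> y y01; rewrite lt_min => /andP[/(d1P _ y01) h yd2].
have sep z : z \in s -> `|z - t| <= `|y - t| -> z = t.
  move=> zs zy; apply/eqP/negPn/negP => /(d2P _ zs) /le_trans /(_ zy).
  by rewrite leNgt yd2.
have /andP[t0 t1] := t01; have /andP[y0 y1] := y01.
have [ty|/ltW yt] := leP t y.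
  have H : ell y - ell t < `|g y - g t| + e / 2.
    apply: short => // z zs; have [|tz] := leP z t; first by left.
    right; rewrite leNgt; apply/negP => zy.
    have := sep z zs; rewrite !ger0_norm ?subr_ge0 ?(ltW tz)// => H.
    have : z = t by apply: H; lra.
    by move=> zt; rewrite zt ltxx in tz.
  have := arc_length_le t0 ty y1.
  move=> ?; rewrite ger0_norm ?subr_ge0//; lra.
have H : ell t - ell y < `|g t - g y| + e / 2.
  apply: short => // z zs; have [|tz] := leP z y; first by left.
  right; rewrite leNgt; apply/negP => zy.
  have := sep z zs; rewrite !ler0_norm ?subr_le0 ?(ltW zy)// => H.
  have : z = t by apply: H; lra.
  by move=> zt; rewrite zt ltxx in zy.
have := arc_length_le y0 yt t1.
rewrite distrC in h.
move=> ?; rewrite distrC ger0_norm ?subr_ge0//; lra.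
Qed.

(** All parameters with the same arc length give the same point, so the choice
    made by [arc_length_param] is harmless. *)
Lemma arc_length_param_ell t : 0 <= t <= 1 -> arc_length_param g (ell t) = g t.
Proof.
move=> t01; rewrite /arc_length_param.
set u := xget _ _; have [u01] : [set t' | 0 <= t' <= 1 /\ arc_length 0 t' g = (ell t)%:E] u.
  by apply: xgetPex; exists t; rewrite /= arc_length_fineK.
rewrite -arc_length_fineK// => -[] uE; apply/eqP; rewrite -subr_eq0 -normr_le0.
have /andP[t0 t1] := t01; have /andP[u0 u1] := u01.
have [tu|/ltW ut] := leP t u.
  by rewrite (le_trans (arc_length_dist t0 tu u1))// uE subrr.
by rewrite distrC (le_trans (arc_length_dist u0 ut t1))// uE subrr.
Qed.

Lemma arc_length_onto l : 0 <= l <= ell 1 -> exists2 t, 0 <= t <= 1 & ell t = l.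
Proof.
move=> /andP[l0 l1]; have [|t] := IVT ler01 arc_length_continuous (v := l).
  by rewrite arc_lengthxx/= min_l ?max_r ?l0// (le_trans l0).
by rewrite in_itv/=; exists t.
Qed.

Lemma arc_length_param_lipschitz l1 l2 :
  0 <= l1 <= ell 1 -> 0 <= l2 <= ell 1 ->
  `|arc_length_param g l2 - arc_length_param g l1| <= `|l2 - l1|.
Proof.
move=> /arc_length_onto[t1 /[dup] h1 /andP[t10 t11] <-].
move=> /arc_length_onto[t2 /[dup] h2 /andP[t20 t21] <-].
rewrite !arc_length_param_ell//; have [t12|/ltW t12] := leP t1 t2.
  by rewrite (le_trans (arc_length_dist t10 t12 t21))// ler_norm.
by rewrite distrC [leRHS]distrC (le_trans (arc_length_dist t20 t12 t11))// ler_norm.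
Qed.

End rectifiable_curve.

(** * The angle swept by a Lipschitz curve around the origin *)

Lemma lipschitz_continuous (R : realType) (V : normedModType R) (f : R -> V) :
  (forall s t, `|f t - f s| <= `|t - s|) -> continuous f.
Proof.
move=> lf s; apply/cvgrPdist_lt => e e0; near=> t.
by rewrite (le_lt_trans (lf _ _)).
Unshelve. all: by end_near. Qed.

Section angle_integral.
Variables (R : realType) (sigma : R -> Rcomplex R) (m : R).
Hypothesis sigma_lip : forall s t, `|sigma t - sigma s| <= `|t - s|.
Hypothesis m_gt0 : 0 < m.
Hypothesis m_le : forall s, m <= `|sigma s|.
Implicit Types u v s t e : R.

Local Notation phi := (fun s : R => `|sigma s|^-1).
Local Notation J u v := (\int[lebesgue_measure]_(s in `[u, v]) (phi s : R)).

Let sigma_gt0 s : 0 < `|sigma s|.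
Proof. exact: lt_le_trans (m_le s). Qed.

Let sigma_neq0 s : sigma s != 0.
Proof. by rewrite -normr_gt0. Qed.

Lemma lipschitz_norm_inv_continuous : continuous (phi : R -> R).
Proof.
move=> s; apply: (@cvgV _ _ _ _ (fun s : R => `|sigma s|)); first by rewrite gt_eqF.
by apply: cvg_norm; exact: lipschitz_continuous.
Qed.

Lemma lipschitz_norm_inv_integrable u v :
  lebesgue_measure.-integrable `[u, v] (EFin \o phi).
Proof.
apply: continuous_compact_integrable; first exact: segment_compact.
exact/continuous_subspaceT/lipschitz_norm_inv_continuous.
Qed.

Let J_ge0 u v : 0 <= J u v.
Proof. by apply: Rintegral_ge0 => s _; rewrite invr_ge0. Qed.

Lemma norm_inv_integral_chasles u v w : u <= v -> v <= w -> J u w = J u v + J v w.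
Proof.
move=> uv vw; have := @Rintegral_itvB R phi (BLeft u) (BRight w) v
  (lipschitz_norm_inv_integrable u w).
rewrite !bnd_simp => /(_ uv vw) H; apply/eqP; rewrite addrC -subr_eq; apply/eqP.
rewrite H Rintegral_itv_obnd_cbnd//.
apply: (integrableS _ _ _ (lipschitz_norm_inv_integrable v w)) => //.
by apply: subset_itvr; rewrite bnd_simp.
Qed.

Let J_lbound s t : s <= t -> (t - s) / (`|sigma s| + (t - s)) <= J s t.
Proof.
move=> st; pose c := (`|sigma s| + (t - s))^-1.
have -> : (t - s) / (`|sigma s| + (t - s)) = \int[lebesgue_measure]_(x in `[s, t]) c.
  rewrite Rintegral_cst//= lebesgue_measure_itv/= lte_fin.
  have [_|] := ltP s t; first by rewrite -EFinB/= mulrC.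
  by move=> ts; rewrite (_ : t = s) ?subrr ?mul0r ?mulr0//; apply/le_anti/andP.
apply: le_Rintegral => //.
- apply: continuous_compact_integrable; first exact: segment_compact.
  exact/continuous_subspaceT/cst_continuous.
- exact: lipschitz_norm_inv_integrable.
move=> x /=; rewrite in_itv/= => /andP[sx xt].
rewrite lef_pV2 ?posrE//; last by rewrite ltr_wpDr// subr_ge0.
have := ler_normD (sigma s) (sigma x - sigma s); rewrite (addrC (sigma s)) subrK.
by move=> /le_trans; apply; rewrite lerD2l (le_trans (sigma_lip _ _))// ger0_norm; lra.
Qed.

(* the step is short enough for q := (t - s) / |sigma s| to be at most e / 20 *)
Let local_angle e s t : 0 < e <= 1 / 2 -> s <= t <= s + m * (e / 20) ->
  (1 + e) * J s t <= pi ->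
  cos ((1 + e) * J s t) <= cos_angle (sigma s) (sigma t).
Proof.
move=> /andP[e0 e1] /andP[st ts] Jpi.
have sm := m_le s; have s0 := sigma_gt0 s.
set M := `|sigma s| in sm s0 *.
have [q0 qe] : 0 <= (t - s) / M /\ (t - s) / M <= e / 20.
  split; first by rewrite divr_ge0 ?subr_ge0// ltW.
  rewrite ler_pdivrMr//; have : m * (e / 20) <= M * (e / 20).
    by rewrite ler_wpM2r// divr_ge0// ltW.
  lra.
have h : (1 + e) * ((t - s) / M / (1 + (t - s) / M)) <= (1 + e) * J s t.
  rewrite ler_wpM2l//; first lra.
  apply: le_trans (J_lbound st); rewrite le_eqVlt; apply/orP; left; apply/eqP.
  rewrite -/M; field; rewrite !gt_eqF//; lra.
apply: (@le_trans _ _ (cos ((1 + e) * ((t - s) / M / (1 + (t - s) / M))))).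
  have h1 : 0 <= (1 + e) * ((t - s) / M / (1 + (t - s) / M)).
    by rewrite mulr_ge0 ?divr_ge0//; lra.
  by rewrite ler_cos ?in_itv/=; lra.
apply: (le_trans (@cos_short_angle R e _ _ _)); [lra|lra|].
have rM : t - s < M.
  by rewrite -[ltRHS]mul1r -ltr_pdivrMr//; lra.
apply: le_trans (@cos_angle_chord _ (sigma s) (sigma t) (t - s) _ _).
- rewrite le_eqVlt; apply/orP; left; apply/eqP; rewrite -/M.
  by field; rewrite !gt_eqF//; lra.
- by rewrite -/M; lra.
- by rewrite (le_trans (sigma_lip _ _))// ger0_norm// subr_ge0.
Qed.

Let global_angle e u v : 0 < e <= 1 / 2 -> u <= v -> (1 + e) * J u v <= pi ->
  cos ((1 + e) * J u v) <= cos_angle (sigma u) (sigma v).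
Proof.
move=> he uv; have [e0 _] := andP he.
have h0 : 0 < m * (e / 20) by rewrite mulr_gt0// divr_gt0.
have [n vn] : exists n : nat, v <= u + n%:R * (m * (e / 20)).
  exists (Num.truncn ((v - u) / (m * (e / 20)))).+1.
  by rewrite -lerBlDl -ler_pdivrMr// ltW// truncnS_gt.
elim: n v uv vn => [|n IH] v uv vn Jpi.
  have -> : v = u by lra.
  by rewrite cos_anglexx// cos_le1.
have [vn'|vn'] := leP v (u + n%:R * (m * (e / 20))); first exact: IH.
set w := u + n%:R * (m * (e / 20)) in vn'.
have uw : u <= w by rewrite lerDl mulr_ge0// ltW.
have wv := ltW vn'.
have E := norm_inv_integral_chasles uw wv; rewrite E mulrDr in Jpi *.
have J1 : 0 <= (1 + e) * J u w by rewrite mulr_ge0//; lra.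
have J2 : 0 <= (1 + e) * J w v by rewrite mulr_ge0//; lra.
apply: (@cos_angleD _ _ (sigma w)) => //.
  by apply: IH => //; lra.
apply: local_angle => //; last lra.
by rewrite wv/= (le_trans vn)// /w -(natr1 n) mulrDl mul1r addrA.
Qed.

(** The angle swept around the origin by [sigma] is at most the integral of the
    inverse of its distance to the origin; here the ends of the arc are in
    opposite directions. *)
Lemma pi_le_integral_opposite u v k : u <= v -> 0 < k ->
  sigma v = - (k *: sigma u) -> pi <= J u v.
Proof.
move=> uv k0 vE; rewrite leNgt; apply/negP => Jpi.
have J0 := J_ge0 u v; have pi0 := pi_gt0 R.
have d0 : 0 < pi - J u v by lra.
pose e := Num.min (1 / 2) ((pi - J u v) / (2 * pi)).
have e0 : 0 < e by rewrite /e lt_min divr_gt0//= divr_gt0//; lra.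
have e1 : e <= 1 / 2 by rewrite /e ge_min lexx.
have e2 : e <= (pi - J u v) / (2 * pi) by rewrite /e ge_min lexx orbT.
have eJ : (1 + e) * J u v < pi.
  have : e * J u v <= (pi - J u v) / (2 * pi) * pi by rewrite ler_pM//; lra.
  have -> : (pi - J u v) / (2 * pi) * pi = (pi - J u v) / 2 by field; lra.
  lra.
have := @global_angle e u v; rewrite e0 e1 vE cos_angleNZ// => /(_ isT uv (ltW eJ)).
have eJ0 : 0 <= (1 + e) * J u v by rewrite mulr_ge0//; lra.
by apply/negP; rewrite -ltNge -cospi ltr_cos ?in_itv/=; lra.
Qed.

End angle_integral.

(** * Non-trivial closed curves in a domain *)

Section curve_around_point.
Variables (R : realType) (g : R -> Rcomplex R).
Hypothesis g_cont : {within `[0, 1], continuous g}.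
Hypothesis g_rect : rectifiable g.

Local Notation ell t := (fine (arc_length 0 t g)).

(** If the closed curve [g] passes through the ends of a segment containing [a]
    in its interior, each of the two arcs of [g] turns around [a] by at least
    pi. *)
Lemma two_pi_le_integral_inv_dist (a : Rcomplex R) (t k : R) :
  g 0 = g 1 -> (forall x : R, 0 <= x <= 1 -> g x != a) -> 0 <= t <= 1 -> 0 < k ->
  g t - a = - (k *: (g 0 - a)) ->
  ((2 * pi)%:E <= arc_length_integral g (fun z => `|z - a|^-1)%R)%E.
Proof.
move=> g01 ga t01 k0 gt.
have /andP[t0 t1] := t01.
have I0 : 0 <= (0 : R) <= 1 by rewrite lexx ler01.
have I1 : 0 <= (1 : R) <= 1 by rewrite lexx ler01.
have L0 : ell 0 = 0 by rewrite arc_lengthxx.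
have Lt0 : 0 <= ell t by rewrite fine_ge0// arc_length_ge0.
have LtL : ell t <= ell 1 by rewrite (arc_length_le g_rect).
have LL : 0 <= ell 1 by exact: le_trans LtL.
pose sigma s := arc_length_param g (clamp 0 (ell 1) s) - a.
have sigmaE (x : R) : 0 <= x <= 1 -> sigma (ell x) = g x - a.
  move=> /[dup] x01 /andP[x0 x1]; rewrite /sigma clamp_id ?arc_length_param_ell//.
  by rewrite fine_ge0 ?arc_length_ge0// (arc_length_le g_rect).
have sigma_lip (u v : R) : `|sigma v - sigma u| <= `|v - u|.
  rewrite /sigma opprB addrA subrK.
  by rewrite (le_trans _ (clamp_lipschitz _ _ LL))// arc_length_param_lipschitz// clamp_itv.
have sigma_cont : {within `[0, ell 1], continuous (fun s => `|sigma s|)}.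
  apply: continuous_subspaceT => s; apply: cvg_norm.
  exact: (lipschitz_continuous sigma_lip).
have [c _ cmin] := EVT_min LL sigma_cont.
have sigma0 s : 0 < `|sigma s|.
  have [x x01 xE] := arc_length_onto g_cont g_rect (clamp_itv s LL).
  by rewrite /sigma -xE arc_length_param_ell// normr_gt0 subr_eq0 ga.
have sigma_min s : `|sigma c| <= `|sigma s|.
  rewrite (_ : sigma s = sigma (clamp 0 (ell 1) s)).
    by apply: cmin; rewrite in_itv/= clamp_itv.
  by rewrite /sigma (@clamp_id _ _ _ (clamp _ _ _))// clamp_itv.
have E0 : sigma 0 = g 0 - a by rewrite -sigmaE// L0.
have E1 : sigma (ell t) = - (k *: sigma 0) by rewrite sigmaE// E0.
have E2 : sigma (ell 1) = - (k^-1 *: sigma (ell t)).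
  by rewrite E1 scalerN opprK scalerA mulVf ?gt_eqF// scale1r sigmaE// -g01.
have J1 := pi_le_integral_opposite sigma_lip (sigma0 c) sigma_min Lt0 k0 E1.
have k1 : 0 < k^-1 by rewrite invr_gt0.
have J2 := pi_le_integral_opposite sigma_lip (sigma0 c) sigma_min LtL k1 E2.
have int := lipschitz_norm_inv_integrable sigma_lip (sigma0 c) sigma_min 0 (ell 1).
rewrite /arc_length_integral
  (_ : integral _ _ _ = (\int[lebesgue_measure]_(s in `[0%R, ell 1]) `|sigma s|^-1)%:E).
  rewrite lee_fin (norm_inv_integral_chasles sigma_lip (sigma0 c) sigma_min Lt0 LtL).
  lra.
rewrite /Rintegral fineK ?integrable_fin_num//.
apply: eq_integral => s; rewrite inE/= in_itv/= => sL.
by rewrite /sigma clamp_id.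
Qed.

End curve_around_point.

(** Monotonicity of the integral of nonnegative functions, measurable or not. *)
Lemma ge0_le_integral_nonmeasurable d (T : measurableType d) (R : realType)
    (mu : {measure set T -> \bar R}) (D : set T) (f1 f2 : T -> \bar R) :
  (forall x, D x -> (0 <= f1 x)%E) -> (forall x, D x -> (f1 x <= f2 x)%E) ->
  (\int[mu]_(x in D) f1 x <= \int[mu]_(x in D) f2 x)%E.
Proof.
move=> f10 f12; rewrite !ge0_integralE//; last first.
  by move=> x Dx; exact: le_trans (f10 _ Dx) (f12 _ Dx).
apply: le_ereal_sup => _ [h hf <-]; exists h => // x.
apply: le_trans (hf x) _; rewrite /patch; case: ifPn => //; rewrite inE; exact: f12.
Qed.

Section domain_geometry.
Variable R : realType.
Local Notation C := (Rcomplex R).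
Implicit Types (D : set C) (x y z a : C).

Lemma boundaryE D : open D -> boundary D = closure D `\` D.
Proof. by move=> /interior_id oD; rewrite /boundary oD. Qed.

Lemma segment_continuous x y : continuous (fun t : R => (1 - t) *: x + t *: y).
Proof.
move=> t; apply: cvgD; apply: cvgZr_tmp; last exact: cvg_id.
by apply: cvgB; [exact: cvg_cst|exact: cvg_id].
Qed.

Lemma segment_meets_boundary D x y t : open D -> D x -> D y -> 0 <= t <= 1 ->
  ~ D ((1 - t) *: x + t *: y) ->
  exists2 u, 0 < u < 1 & boundary D ((1 - u) *: x + u *: y).
Proof.
move=> oD Dx Dy t01 Dt; set h := fun t : R => (1 - t) *: x + t *: y.
have hc : continuous h by exact: segment_continuous.
have h0 : h 0 = x by rewrite /h subr0 scale1r scale0r addr0.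
have h1 : h 1 = y by rewrite /h subrr scale1r scale0r add0r.
apply: contrapT => noB.
have bd u : 0 <= u <= 1 -> closure D (h u) -> D (h u).
  move=> /andP[u0 u1] cu; apply: contrapT => Du; apply: noB; exists u; last first.
    by rewrite boundaryE.
  rewrite !lt_neqAle u0 u1 !andbT; apply/andP; split; apply/eqP => uE.
    by apply: Du; rewrite -uE h0.
  by apply: Du; rewrite uE h1.
have : `[0, 1] `&` h @^-1` D = `[0, 1]%classic.
  apply: (@segment_connected R 0 1).
  - by exists 0; split; [rewrite /= in_itv/= lexx ler01|rewrite /= h0].
  - by exists (h @^-1` D) => //; apply: open_comp.
  exists (h @^-1` closure D); first by apply: closed_comp => //; exact: closed_closure.
  apply/seteqP; split => u [/= u01 hu]; split => //.
    exact: subset_closure.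
  by apply: bd => //; rewrite in_itv in u01.
move=> /seteqP[_ /(_ t)]; rewrite /= in_itv/= => /(_ t01)[_]; exact: Dt.
Qed.

Lemma dist_boundary_le D z a : boundary D a -> dist_boundary D z <= `|z - a|.
Proof.
move=> Da; apply: ge_inf; last by exists a.
by exists 0 => _ [xi _ <-].
Qed.

Lemma dist_boundary_gt0 D z a : open D -> D z -> boundary D a -> 0 < dist_boundary D z.
Proof.
move=> oD Dz Da; have /nbhs_ballP[e /= e0 eD] := open_nbhs_nbhs (conj oD Dz).
apply: (lt_le_trans e0); apply: lb_le_inf; first by exists `|z - a|, a.
move=> _ [xi + <-]; rewrite boundaryE// => -[_ Dxi].
rewrite leNgt; apply/negP => h; apply: Dxi; apply: eD.
by rewrite -ball_normE.
Qed.

(** The strict inequality keeps the denominator of [m_density] positive when [D]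
    is bounded. *)
Lemma dist_boundary_lt_diameter D z a : open D -> D z -> boundary D a ->
  ((dist_boundary D z)%:E < diameter D)%E.
Proof.
move=> oD Dz Da; have /nbhs_ballP[e /= e0 eD] := open_nbhs_nbhs (conj oD Dz).
have za : 0 < `|z - a|.
  rewrite normr_gt0 subr_eq0; apply/eqP => zE.
  by move: Da; rewrite boundaryE// -zE => -[].
(* a point w of D beyond z on the ray from a, and a point v of D near a *)
pose w := z + (e / 2 / `|z - a|) *: (z - a).
have Dw : D w.
  apply: eD; rewrite -ball_normE/= /w opprD addrA subrr sub0r normrN normrZ.
  rewrite normf_div normr_id divfK ?gt_eqF// gtr0_norm ?divr_gt0//.
  by rewrite ltr_pdivrMr// ltr_pMr// ltr1n.
have wa : `|w - a| = `|z - a| + e / 2.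
  have -> : w - a = (1 + e / 2 / `|z - a|) *: (z - a).
    by rewrite scalerDl scale1r /w addrAC.
  rewrite normrZ ger0_norm ?addr_ge0// ?divr_ge0// ?ltW//.
  by rewrite mulrDl mul1r divfK// gt_eqF.
have [ca _] : closure D a /\ ~ D a by move: Da; rewrite boundaryE.
have e40 : 0 < e / 4 by rewrite divr_gt0.
have [v [Dv]] := ca _ (nbhsx_ballx a _ e40).
rewrite -ball_normE/= => av.
have wv : (`|w - v|%R%:E <= diameter D)%E.
  by apply: ereal_sup_ubound; exists (w, v).
apply: lt_le_trans wv; rewrite lte_fin.
apply: (le_lt_trans (dist_boundary_le z Da)).
have := ler_distD v w a; rewrite wa (distrC v); lra.
Qed.

Lemma m_density_ge_inv_dist D z a : open D -> D z -> boundary D a ->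
  `|z - a|^-1 <= m_density D z.
Proof.
move=> oD Dz Da; rewrite /m_density.
have d0 := dist_boundary_gt0 oD Dz Da; have dd := dist_boundary_lt_diameter oD Dz Da.
have dz := dist_boundary_le z Da.
set delta := dist_boundary D z in d0 dd dz *.
have h : `|z - a|^-1 <= delta^-1 by rewrite lef_pV2 ?posrE// (lt_le_trans d0).
apply: (le_trans h); move: dd; case: (diameter D) => [d| |]//.
rewrite lte_fin => dd.
have -> : d / (delta * (d - delta)) = delta^-1 * (d / (d - delta)).
  by rewrite invfM mulrCA.
rewrite ler_peMr ?invr_ge0 ?(ltW d0)// ler_pdivlMr ?subr_gt0//.
by rewrite mul1r gerBl ltW.
Qed.

(** The straight-line homotopy; [clamp] extends [g] continuously to the line. *)
Lemma null_homotopic_of_star_shaped D (g : R -> C) : closed_curve_in D g ->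
  (forall s t, 0 <= s <= 1 -> 0 <= t <= 1 -> D ((1 - t) *: g s + t *: g 0)) ->
  null_homotopic_in D g.
Proof.
move=> [cg g01 gD] star.
have I0 : 0 <= (0 : R) <= 1 by rewrite lexx ler01.
have I1 : 0 <= (1 : R) <= 1 by rewrite lexx ler01.
have gc : continuous (fun p : R * R => g (clamp 0 1 p.2)).
  move=> p; have h := continuous_clamp ler01 cg.
  exact: (@cvg_comp _ _ _ snd (fun x : R => g (clamp 0 1 x)) _ (nbhs p.2)
    _ cvg_snd (h p.2)).
exists (g 0); first by apply: gD; exists 0; rewrite //= in_itv.
exists (fun p => (1 - p.1) *: g (clamp 0 1 p.2) + p.1 *: g 0); split.
- apply: continuous_subspaceT => p; apply: cvgD; apply: cvgZ.
  + by apply: cvgB; [exact: cvg_cst|exact: cvg_fst].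
  + exact: gc.
  + exact: cvg_fst.
  + exact: cvg_cst.
- move=> _ [[t s] /= [] + + <-]; rewrite !in_itv/= => t01 s01.
  by apply: star => //; rewrite clamp_id.
- by move=> s; rewrite in_itv/= => s01; rewrite subr0 scale1r scale0r addr0 clamp_id.
- by move=> s _; rewrite subrr scale1r scale0r add0r.
- by move=> t _; rewrite /= !clamp_id// g01.
Qed.

Lemma two_pi_le_m_density_integral D (g : R -> C) : open D ->
  closed_curve_in D g -> rectifiable g -> ~ null_homotopic_in D g ->
  ((2 * pi)%:E <= arc_length_integral g (m_density D))%E.
Proof.
move=> oD cg rg ng; have [g_cont g01 gD'] := cg.
have gD (s : R) : 0 <= s <= 1 -> D (g s).
  by move=> s01; apply: gD'; exists s; rewrite //= in_itv.
have I0 : 0 <= (0 : R) <= 1 by rewrite lexx ler01.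
have [s [t [s01 t01 Dst]]] : exists s t : R, [/\ 0 <= s <= 1, 0 <= t <= 1 &
    ~ D ((1 - t) *: g s + t *: g 0)].
  apply: contrapT => H; apply: ng; apply: null_homotopic_of_star_shaped => // s t s01 t01.
  by apply: contrapT => Dst; apply: H; exists s, t.
have [u /andP[u0 u1] Da] := segment_meets_boundary oD (gD s s01) (gD 0 I0) t01 Dst.
set a := _ + _ in Da.
have ga (x : R) : 0 <= x <= 1 -> g x != a.
  move=> x01; apply/eqP => gE; move: Da; rewrite boundaryE// -gE => -[_]; apply.
  exact: gD.
have u1' : 0 < 1 - u by rewrite subr_gt0.
have gs : g s - a = - ((u / (1 - u)) *: (g 0 - a)).
  have -> : g 0 - a = (1 - u) *: (g 0 - g s).
    by rewrite /a opprD addrA scalerBr [in RHS](scalerBl _ _ (g 0)) scale1r addrAC.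
  rewrite scalerA divfK ?gt_eqF// -scalerN opprB /a.
  by rewrite scalerBr scalerBl scale1r !opprD opprK !addrA subrr add0r.
apply: (le_trans (two_pi_le_integral_inv_dist g_cont rg g01 ga s01 (divr_gt0 u0 u1') gs)).
apply: ge0_le_integral_nonmeasurable => l; rewrite /= in_itv/= => l01.
  by rewrite lee_fin invr_ge0.
have [x x01 <-] := arc_length_onto g_cont rg l01.
rewrite arc_length_param_ell// lee_fin; apply: m_density_ge_inv_dist => //.
exact: gD.
Qed.

End domain_geometry.

(** * Circles in a punctured disc *)

Section circle.
Variable R : realType.
Local Notation C := (Rcomplex R).
Implicit Types (r t x y rho : R).

Lemma norm_circle r t : 0 <= r -> `|circle r t : C| = r.
Proof.
move=> r0; apply/eqP; rewrite -(@eqrXn2 _ 2)//; apply/eqP.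
rewrite Rcomplex_norm_sqr/= !exprMn -mulrDr.
by rewrite cos2Dsin2 mulr1.
Qed.

Lemma circle_lipschitz r x y : 0 <= r ->
  `|(circle r y : C) - circle r x| <= 2 * pi * r * `|y - x|.
Proof.
move=> r0; have pi0 := pi_ge0 R.
rewrite -(ler_pXn2r (ltn0Sn 1)) ?nnegrE ?mulr_ge0// exprMn real_normK ?num_real//.
have -> : `|(circle r y : C) - circle r x| ^+ 2 =
    r ^+ 2 * (2 - 2 * cos (2 * pi * y - 2 * pi * x)).
  have := cos2Dsin2 (2 * pi * y); have := cos2Dsin2 (2 * pi * x).
  rewrite Rcomplex_norm_sqr/= cosB; set c := cos _; set s := sin _.
  move=> h1 h2; rewrite (_ : 2 - _ = (c ^+ 2 + s ^+ 2) +
    (cos (2 * pi * y) ^+ 2 + sin (2 * pi * y) ^+ 2) -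
    2 * (cos (2 * pi * y) * c + sin (2 * pi * y) * s)); last by rewrite h1 h2; ring.
  by ring.
have := cos_ge_quadratic (2 * pi * y - 2 * pi * x).
rewrite -mulrBr; set u := 2 * pi * (y - x) => h.
apply: (@le_trans _ _ (r ^+ 2 * u ^+ 2)); last first.
  by rewrite le_eqVlt; apply/orP; left; apply/eqP; rewrite /u; ring.
by rewrite ler_wpM2l ?sqr_ge0//; lra.
Qed.

Lemma circle_continuous r : 0 <= r -> {within `[0, 1], continuous (circle r : R -> C)}.
Proof.
move=> r0; apply/within_segment_continuousP => x e _ e0.
have c0 : 0 < 2 * pi * r + 1 by rewrite ltr_wpDl// !mulr_ge0// pi_ge0.
exists (e / (2 * pi * r + 1)); first exact: divr_gt0.
move=> y _; rewrite ltr_pdivlMr// => yx.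
apply: le_lt_trans (circle_lipschitz _ _ r0) _.
have := normr_ge0 (y - x); lra.
Qed.

Lemma chord_sum_circle_le r a b s : 0 <= r -> itv_partition a b s ->
  chord_sum a b (circle r) s <= 2 * pi * r * (b - a).
Proof.
move=> r0; elim: s a => [a /itv_partition_nil ->|x s IH a ps].
  by rewrite chord_sum_nil subrr mulr0.
have ax : a < x by case: ps => /= /andP[].
rewrite chord_sum_cons; have := IH x (itv_partition_cons ps).
have := circle_lipschitz a x r0; rewrite gtr0_norm ?subr_gt0//; lra.
Qed.

Lemma arc_length_circle_le r : 0 <= r -> (arc_length 0%R 1%R (circle r) <= (2 * pi * r)%:E)%E.
Proof.
move=> r0; apply: ge_ereal_sup => _ [s ps <-].
by rewrite lee_fin (le_trans (chord_sum_circle_le r0 ps))// subr0 mulr1.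
Qed.

(** The points of [arc_length_param (circle r)] are on the circle whatever
    parameter is chosen. *)
Lemma arc_length_integral_circle_cst r (f : C -> R) c :
  (forall t, f (circle r t) = c) ->
  arc_length_integral (circle r) f = (c * fine (arc_length 0 1 (circle r)))%:E.
Proof.
move=> fc; set L := fine _; have L0 : 0 <= L by rewrite fine_ge0// arc_length_ge0.
rewrite /arc_length_integral.
under eq_integral do rewrite [f _]fc.
rewrite integral_cst//= lebesgue_measure_itv/= lte_fin -/L.
case: ltP => [_|L0']; first by rewrite -EFinB subr0 -EFinM.
have -> : L = 0 by apply/le_anti/andP.
by rewrite mulr0 mule0.
Qed.

Lemma arc_length_circle r : 0 < r -> arc_length 0 1 (circle r) = (2 * pi * r)%:E.
Proof.
move=> r0; have r0' := ltW r0.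
have rect : rectifiable (circle r) by exact: le_lt_trans (arc_length_circle_le r0') (ltry _).
apply/eqP; rewrite eq_le arc_length_circle_le//=.
have half : 0 <= 1 / 2 :> R /\ 1 / 2 <= 1 :> R by split; lra.
(* opposite points of the circle are seen from its centre under the angle pi *)
suff : ((2 * pi)%:E <= arc_length_integral (circle r) (fun z => `|z - 0|^-1)%R)%E.
  rewrite (@arc_length_integral_circle_cst r _ r^-1); last first.
    by move=> t; rewrite subr0 norm_circle.
  rewrite -(arc_length_fineK rect) ?lexx ?ler01// !lee_fin.
  by rewrite [leRHS]mulrC ler_pdivlMr.
apply: (@two_pi_le_integral_inv_dist R (circle r) (circle_continuous r0') rect 0 (1 / 2) 1).
- rewrite /circle mulr0 mulr1 cos0 sin0; congr (_ +i* _)%C.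
    by rewrite mulr_natl cos2pi.
  by rewrite mulr_natl sin2pi.
- by move=> x _; rewrite -normr_gt0 norm_circle.
- by rewrite half.1 half.2.
- exact: ltr01.
rewrite !subr0 scale1r /circle mulr0 cos0 sin0 (_ : 2 * pi * (1 / 2) = pi); last by field.
by rewrite cospi sinpi; simpc.
Qed.

Lemma punctured_disc_open rho : open (punctured_disc rho).
Proof.
have -> : punctured_disc rho = (fun z : C => `|z|) @^-1` `]0, rho[%classic.
  by apply/seteqP; split => z /=; rewrite in_itv.
apply: open_comp; last exact: interval_open.
by move=> z _; exact: norm_continuous.
Qed.

Lemma punctured_disc_boundary0 rho : 0 < rho -> boundary (punctured_disc rho) 0.
Proof.
move=> rho0; rewrite boundaryE; last exact: punctured_disc_open.
split; last by rewrite /punctured_disc/= normr0 ltxx.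
move=> B /nbhs_ballP[e /= e0 eB].
pose s := Num.min e rho / 2.
have s0 : 0 < s by rewrite divr_gt0// lt_min e0.
have [se sr] : Num.min e rho <= e /\ Num.min e rho <= rho by rewrite !ge_min !lexx orbT.
exists (circle s 0); split.
  by rewrite /punctured_disc/= norm_circle ?ltW// s0/=; move: s0; rewrite /s; lra.
apply: eB; rewrite -ball_normE/= sub0r normrN norm_circle ?ltW//.
by move: s0; rewrite /s; lra.
Qed.

Lemma dist_boundary_punctured_disc rho (z : C) : 0 < `|z| -> 2 * `|z| <= rho ->
  dist_boundary (punctured_disc rho) z = `|z|.
Proof.
move=> z0 zrho; have rho0 : 0 < rho by lra.
have B0 := punctured_disc_boundary0 rho0.
apply/eqP; rewrite eq_le -{1}[z in leRHS]subr0 dist_boundary_le//=.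
apply: lb_le_inf; first by exists `|z - 0|, 0.
move=> _ [xi + <-]; rewrite boundaryE; last exact: punctured_disc_open.
move=> [_ /negP]; rewrite negb_and -leNgt normr_le0 -leNgt.
move=> /orP[/eqP ->|xirho]; first by rewrite subr0.
have := lerB_dist xi z; rewrite distrC; lra.
Qed.

Lemma diameter_punctured_disc rho : 0 < rho ->
  diameter (punctured_disc rho) = (2 * rho)%:E.
Proof.
move=> rho0; apply/eqP; rewrite eq_le; apply/andP; split.
  apply: ge_ereal_sup => _ [[x y] [/= /andP[_ hx] /andP[_ hy]] <-].
  by rewrite lee_fin (le_trans (ler_normB _ _))//; lra.
apply/lee_subgt0Pr => e e0; rewrite -EFinB.
(* antipodal points at distance s from the centre *)
pose s := Num.max (rho / 2) (rho - e / 2).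
have [s1 s2] : rho / 2 <= s /\ rho - e / 2 <= s by rewrite !le_max !lexx orbT.
have s3 : s < rho by rewrite gt_max; apply/andP; split; lra.
have s0 : 0 < s by lra.
apply: (@le_trans _ _ (2 * s)%:E); first by rewrite lee_fin; lra.
apply: ereal_sup_ubound; exists (circle s 0, - circle s 0).
  by split; rewrite /punctured_disc/= ?normrN norm_circle ?ltW// s0.
rewrite /= opprK -mulr2n -scaler_nat normrZ norm_circle ?ltW//.
by rewrite ger0_norm.
Qed.

Lemma m_density_circle_integral r rho : 0 < r -> 2 * r <= rho ->
  arc_length_integral (circle r) (m_density (punctured_disc rho)) =
  (2 * pi * (1 - r / (2 * rho))^-1)%:E.
Proof.
move=> r0 rrho; have rho0 : 0 < rho by lra.
rewrite (@arc_length_integral_circle_cst r _ (2 * rho / (r * (2 * rho - r)))).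
  rewrite arc_length_circle//=; congr (_%:E); field.
  by rewrite !gt_eqF//; lra.
move=> t; rewrite /m_density diameter_punctured_disc//.
by have n := norm_circle t (ltW r0); rewrite dist_boundary_punctured_disc n.
Qed.

(** Only the ratio of the radii matters in the limit, so that both limits in the
    theorem are instances of this one. *)
Lemma m_density_circle_limit (T : Type) (F : set_system T) {FF : Filter F}
    (r rho : T -> R) : (\forall p \near F, 0 < r p /\ 2 * r p <= rho p) ->
  r p / rho p @[p --> F] --> (0 : R) ->
  arc_length_integral (circle (r p)) (m_density (punctured_disc (rho p))) @[p --> F]
    --> (2 * pi)%:E.
Proof.
move=> F0 Flim.
have : (2 * pi * (1 - r p / rho p / 2)^-1)%:E @[p --> F] --> (2 * pi * (1 - 0 / 2)^-1)%:E.
  apply: cvg_EFin; first by near=> p.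
  rewrite /comp/=; apply: cvgM; first exact: cvg_cst.
  apply: cvgV; first by rewrite mul0r subr0 oner_neq0.
  apply: cvgB; first exact: cvg_cst.
  by apply: cvgM => //; exact: cvg_cst.
rewrite mul0r subr0 invr1 mulr1; apply: cvg_trans; apply: near_eq_cvg.
near=> p; have [p0 pp] : 0 < r p /\ 2 * r p <= rho p by near: p.
rewrite m_density_circle_integral//; congr (2 * pi * (1 - _)^-1)%:E.
by field; rewrite gt_eqF//; lra.
Unshelve. all: by end_near. Qed.

End circle.

Theorem proposition5p1 (R : realType) :
  [/\ (forall (D : set (Rcomplex R)) (g : R -> Rcomplex R),
        domain D -> D != setT -> multiply_connected D ->
        closed_curve_in D g -> rectifiable g -> ~ null_homotopic_in D g ->
        ((2 * pi)%:E <= arc_length_integral g (m_density D))%E),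
      (forall r : R, 0 < r ->
        arc_length_integral (circle r) (m_density (punctured_disc rho))
          @[rho --> +oo] --> (2 * pi)%:E) &
      (forall rho : R, 0 < rho ->
        arc_length_integral (circle r) (m_density (punctured_disc rho))
          @[r --> 0^'+] --> (2 * pi)%:E)].
Proof.
split=> [D g [oD _ _] _ _ cg rg ng|r r0|rho rho0].
- exact: two_pi_le_m_density_integral.
- apply: (@m_density_circle_limit R R +oo _ (fun=> r) id).
    near=> rho; split=> //=; near: rho; apply: nbhs_pinfty_ge; exact: num_real.
  rewrite -[X in _ --> X](mulr0 r); apply: cvgM; first exact: cvg_cst.
  apply/gtr0_cvgV0; last exact: cvg_id.
  by near=> rho; near: rho; apply: nbhs_pinfty_gt; exact: num_real.
- apply: (@m_density_circle_limit R R 0^'+ _ id (fun=> rho)).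
    near=> r; split=> //=; rewrite mulrC -ler_pdivlMr//.
    by near: r; apply: nbhs_right_le; exact: divr_gt0.
  apply: cvg_at_right_filter; rewrite -[X in _ --> X](mul0r rho^-1).
  by apply: cvgM; [exact: cvg_id|exact: cvg_cst].
Unshelve. all: by end_near. Qed.
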